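(* For any integers $k \ge 3$ and $C \ge 0$, there exists a constant $N = N(k,C)$ such that for all $n \ge N$, every $k$-uniform hypergraph on $n$ vertices has at most $n - C$ different clique sizes; that is, the set $\{|S| : S \text{ is a clique of } \mathcal{H}\}$ has at most $n-C$ elements for every $n$-vertex $k$-uniform hypergraph $\mathcal{H}$.
   Context: Let $k \ge 2$ and let $\mathcal{H}$ be a $k$-uniform hypergraph. A vertex set $S$ of $\mathcal{H}$ forms a complete graph if every $k$-element subset of $S$ is an edge of $\mathcal{H}$. A clique of $\mathcal{H}$ is a vertex set forming a complete graph that is maximal with respect to inclusion, i.e. not contained in any strictly larger vertex set forming a complete graph. *)

(* Defs.v *)
From mathcomp Require Import all_boot.

Set Implicit Arguments.
Unset Strict Implicit.
Unset Printing Implicit Defensive.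

(* A hypergraph on the vertex set T is given by its set E of edges. *)

Definition uniform_hypergraph (k : nat) (T : finType) (E : {set {set T}}) : bool :=
  [forall e in E, #|e| == k].

(* Vacuously true when #|S| < k. *)
Definition complete_in (k : nat) (T : finType) (E : {set {set T}}) (S : {set T}) : bool :=
  [forall e : {set T}, (e \subset S) && (#|e| == k) ==> (e \in E)].

Definition clique (k : nat) (T : finType) (E : {set {set T}}) (S : {set T}) : bool :=
  maxset (complete_in k E) S.

(* 'I_#|T|.+1 = {0, ..., #|T|} contains every possible cardinality. *)
Definition clique_sizes (k : nat) (T : finType) (E : {set {set T}}) :
    {set 'I_#|T|.+1} :=
  [set s : 'I_#|T|.+1 | [exists S : {set T}, clique k E S && (#|S| == s)]].

(* Main.v *)
(** The complements of the cliques are the minimal transversals of the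
    hypergraph of non-edges, so it suffices to find arbitrarily long intervals,
    below a bound depending only on [k], that contain no size of a minimal
    transversal of a hypergraph of rank at most [k].  Given one transversal [A]
    of bounded size, a minimal transversal meeting [A] exactly in [Y] is also a
    minimal transversal of the hypergraph consisting of the points of [Y] and of
    the sets [e :\: A], where [e] is an edge missing [Y]; these sets are smaller
    than [e], because [e] meets [A].  Hence one hypergraph of rank [r + 1] is
    controlled by [2 ^ #|A|] hypergraphs of rank [r].  To treat these
    simultaneously, the length of the interval is allowed to be an arbitrary
    function of its left end. *)

Require Import Defs.
From mathcomp Require Import all_boot.

Set Implicit Arguments.
Unset Strict Implicit.
Unset Printing Implicit Defensive.

Section Transversals.

Variable T : finType.
Implicit Types (F : {set {set T}}) (A Y Z e : {set T}).

Definition transversal F Z : bool := [forall e in F, e :&: Z != set0].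

Definition rank_le r F : bool := [forall e in F, #|e| <= r].

Definition size_gap F p q : Prop :=
  forall Z, minset (transversal F) Z -> ~~ (p <= #|Z| <= q).

Lemma transversalP F Z :
  reflect (forall e, e \in F -> exists2 x, x \in e & x \in Z) (transversal F Z).
Proof.
apply: (iffP forall_inP) => tr e /tr.
  by case/set0Pn=> x /setIP[]; exists x.
by case=> x xe xZ; apply/set0Pn; exists x; rewrite inE xe.
Qed.

Lemma size_gapS F p q p' q' :
  p <= p' -> q' <= q -> size_gap F p q -> size_gap F p' q'.
Proof.
move=> lep leq gap Z /gap; apply: contra => /andP[lepZ leZq].
by rewrite (leq_trans lep) ?(leq_trans leZq).
Qed.

(** Otherwise [Z :\ x] would still meet every edge, against minimality. *)
Lemma minset_transversal_private F Z x :
  minset (transversal F) Z -> x \in Z ->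
  exists2 e, e \in F & e :&: Z = [set x].
Proof.
case/minsetP=> /transversalP trZ minZ xZ.
have: ~~ transversal F (Z :\ x).
  apply/negP=> /minZ/(_ (subD1set Z x))/setP/(_ x).
  by rewrite !inE eqxx xZ.
case/forall_inPn=> e eF /negPn/eqP dis; exists e => //.
have only y : y \in e -> y \in Z -> y = x.
  move=> ye yZ; apply/eqP; apply: contraT => neq.
  by move/setP/(_ y): dis; rewrite !inE ye yZ neq.
have [y ye yZ] := trZ e eF.
have yx := only y ye yZ; rewrite {}yx in ye yZ.
apply/setP=> z; rewrite !inE; apply/andP/eqP => [[]|->//].
exact: only.
Qed.

(** The private edge of a point [x] of [Z] has no other point, so every transversal contains [x]. *)
Lemma minset_transversal_rank1 F Z Z' :
  rank_le 1 F -> minset (transversal F) Z -> minset (transversal F) Z' ->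
  Z = Z'.
Proof.
move/forall_inP=> rkF.
have sub Z1 Z2 : minset (transversal F) Z1 -> minset (transversal F) Z2 ->
    Z1 \subset Z2.
  move=> minZ1 /minsetp/transversalP trZ2; apply/subsetP=> x xZ1.
  have [e eF eZ1] := minset_transversal_private minZ1 xZ1.
  have xe : x \in e by have /setIP[] : x \in e :&: Z1 by rewrite eZ1 set11.
  have [y ye yZ2] := trZ2 e eF.
  by have yx : y = x := card_le1_eqP (rkF e eF) x y xe ye; rewrite -yx.
by move=> mZ mZ'; apply/eqP; rewrite eqEsubset !sub.
Qed.

Definition trace F A Y : {set {set T}} :=
  [set e :\: A | e in F & [disjoint e & Y]] :|: [set [set y] | y in Y].

Lemma rank_le_trace r F A Y :
  0 < r -> transversal F A -> rank_le r.+1 F -> rank_le r (trace F A Y).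
Proof.
move=> r_gt0 /transversalP trA /forall_inP rkF; apply/forall_inP=> e'.
case/setUP=> /imsetP[x]; last by move=> _ ->; rewrite cards1.
rewrite inE => /andP[xF _] ->; rewrite -ltnS.
apply: leq_trans (rkF x xF); apply: proper_card.
have [y yx yA] := trA x xF.
by apply/properP; split; [exact: subsetDl | exists y; rewrite // inE yA].
Qed.

(** A transversal of the trace is one of [F]: the singletons force it to contain [Z :&: A], and an
    edge missing that set is met outside [A]. So minimality of [Z] carries over. *)
Lemma minset_trace F A Z :
  minset (transversal F) Z -> minset (transversal (trace F A (Z :&: A))) Z.
Proof.
case/minsetP=> /transversalP trZ minZ; apply/minsetP; split.
  apply/transversalP=> e' /setUP[]/imsetP[x]; last first.
    by case/setIP=> xZ _ ->; exists x; rewrite ?set11.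
  rewrite inE => /andP[xF dis] ->; have [y yx yZ] := trZ x xF.
  exists y => //; rewrite inE yx andbT; apply/negP=> yA.
  by have := disjointFr dis yx; rewrite inE yZ yA.
move=> Z' /transversalP trZ' sub; apply: minZ => //.
apply/transversalP=> e eF; have [dis|] := boolP [disjoint e & Z :&: A].
  have [|x] := trZ' (e :\: A).
    by apply/setUP; left; apply/imsetP; exists e; rewrite // inE eF.
  by case/setDP=> xe _ xZ'; exists x.
rewrite -setI_eq0 => /set0Pn[x /setIP[xe xZA]]; exists x => //.
have [|y] := trZ' [set x]; first by apply/setUP; right; exact: imset_f.
by rewrite inE => /eqP->.
Qed.

End Transversals.

(* The bound is kept in [Type], so that it is available as a function of [p]
   without any choice axiom. *)
Definition has_gaps r m : Type :=
  forall (f : nat -> nat) p, {N : nat | forall (T : finType)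
    (Fs : seq {set {set T}}), size Fs <= m -> all (rank_le r) Fs ->
    exists2 q, p <= q <= N & forall F, F \in Fs -> size_gap F q (f q)}.

(** There is at most one minimal transversal; if its size lies in [[p, f p]], a start beyond [f p]
    avoids it. *)
Lemma has_gaps_rank1 : has_gaps 1 1.
Proof.
move=> f p; exists (maxn p (f p).+1) => T [|F []] //= _.
  by move=> _; exists p; rewrite ?leqnn ?leq_maxl.
rewrite andbT => rkF.
have [/existsP[Z /andP[minZ /andP[_ leZ]]]|noZ] :=
  boolP [exists Z, minset (transversal F) Z && (p <= #|Z| <= f p)].
  exists (maxn p (f p).+1); first by rewrite leq_maxl leqnn.
  move=> F'; rewrite inE => /eqP-> Z' minZ'.
  rewrite (minset_transversal_rank1 rkF minZ' minZ).
  by rewrite geq_max ltnNge leZ andbF.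
exists p; first by rewrite leqnn leq_maxl.
move=> F'; rewrite inE => /eqP-> Z minZ; apply: contra noZ => szZ.
by apply/existsP; exists Z; rewrite minZ.
Qed.

(* The gap found for the first hypergraph is so long that, wherever it starts,
   it contains the gap common to the others. *)
Lemma has_gaps_seq r m : has_gaps r 1 -> has_gaps r m.
Proof.
move=> gaps1; elim: m => [|m IHm] f p.
  by exists p => T [|//] _ _; exists p; rewrite ?leqnn.
(* Any start [q'] that the induction hypothesis can return from [q] satisfies [f q' <= g q]. *)
pose g q := \max_(i < (sval (IHm f q)).+1) f i.
have [N1 gapN1] := gaps1 g p.
exists (\max_(i < N1.+1) sval (IHm f i)) => T [|F Fs] /=.
  move=> _ _; have [q /andP[lepq leqN] _] := gapN1 T [::] isT isT.
  have [q' /andP[leqq' leq'N] _] := svalP (IHm f q) T [::] isT isT.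
  exists q' => //; rewrite (leq_trans lepq) //=; apply: leq_trans leq'N _.
  by rewrite (bigmax_sup (Ordinal (leqN : q < N1.+1))).
rewrite ltnS => szFs /andP[rkF rkFs].
have [|q /andP[lepq leqN] gapF] := gapN1 T [:: F] isT; first by rewrite /= rkF.
have [q' /andP[leqq' leq'N] gapFs] := svalP (IHm f q) T Fs szFs rkFs.
exists q'.
  rewrite (leq_trans lepq) //=; apply: leq_trans leq'N _.
  by rewrite (bigmax_sup (Ordinal (leqN : q < N1.+1))).
move=> F'; rewrite inE => /predU1P[->|/gapFs//].
apply: size_gapS (gapF F (mem_head _ _)) => //.
exact: (bigmax_sup (Ordinal (leq'N : q' < (sval (IHm f q)).+1))).
Qed.

Lemma has_gaps_rankS r : 0 < r -> (forall m, has_gaps r m) -> has_gaps r.+1 1.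
Proof.
(* A transversal [A] with at most [f p] points has at most [2 ^ f p] subsets, hence as many traces;
   this count does not depend on [F]. *)
move=> r_gt0 gaps f p; have [N gapN] := gaps (2 ^ f p) f p.
exists (maxn p N) => T [|F []] //= _.
  by move=> _; exists p; rewrite ?leqnn ?leq_maxl.
rewrite andbT => rkF.
have [/existsP[A /andP[/minsetp trA /andP[_ leA]]]|noZ] :=
  boolP [exists Z, minset (transversal F) Z && (p <= #|Z| <= f p)].
  have [||q /andP[lepq leqN] gapq] := gapN T (map (trace F A) (enum (powerset A))).
  - by rewrite size_map -cardE card_powerset leq_exp2l.
  - by apply/allP=> _ /mapP[Y _ ->]; exact: rank_le_trace.
  exists q; first by rewrite lepq leq_max leqN orbT.
  move=> F'; rewrite inE => /eqP-> Z minZ.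
  apply: gapq (minset_trace A minZ); apply: map_f.
  by rewrite mem_enum powersetE subsetIr.
exists p; first by rewrite leqnn leq_maxl.
move=> F'; rewrite inE => /eqP-> Z minZ; apply: contra noZ => szZ.
by apply/existsP; exists Z; rewrite minZ.
Qed.

Lemma has_gapsP r m : 0 < r -> has_gaps r m.
Proof.
case: r => // r _; elim: r m => [|r IHr] m; apply: has_gaps_seq.
  exact: has_gaps_rank1.
exact: has_gaps_rankS.
Qed.

Definition non_edges k (T : finType) (E : {set {set T}}) : {set {set T}} :=
  [set e : {set T} | (#|e| == k) && (e \notin E)].

Lemma transversal_non_edges k (T : finType) (E : {set {set T}}) (S : {set T}) :
  transversal (non_edges k E) (~: S) = complete_in k E S.
Proof.
apply: eq_forallb => e; rewrite inE -setDE setD_eq0.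
by case: (#|e| == k); case: (e \in E); case: (e \subset S).
Qed.

Lemma minset_transversal_clique k (T : finType) (E : {set {set T}}) S :
  clique k E S -> minset (transversal (non_edges k E)) (~: S).
Proof.
case/maxsetP=> compS maxS; apply/minsetP.
split=> [|Z trZ subZ]; first by rewrite transversal_non_edges.
rewrite -[Z]setCK in trZ *; congr (~: _).
by apply: maxS; rewrite -?transversal_non_edges // -setCS setCK.
Qed.

Theorem theorem1p1 (k C : nat) (hk : 3 <= k) :
  exists N : nat, forall n : nat, N <= n ->
    forall (T : finType) (E : {set {set T}}),
      #|T| = n -> uniform_hypergraph k E ->
      #|clique_sizes k E| + C <= n.
Proof.
(* The gap [[q, q + C]] excludes [C + 1] of the [n + 1] values [0, ..., n], which leaves [n - C]. *)
have [N gapN] := @has_gapsP k 1 (ltnW (ltnW hk)) (fun q => q + C) 0.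
exists (N + C) => n leNn T E cardT _.
have [|q /andP[_ leqN] gapq] := gapN T [:: non_edges k E] isT.
  by rewrite /= andbT; apply/forall_inP=> e; rewrite inE => /andP[/eqP->].
have leqCn : q + C <= n by apply: leq_trans leNn; rewrite leq_add2r.
(* Complementation turns the gap into missing clique sizes; they are distinct because [q + C <= n]
   rules out truncated subtraction. *)
pose miss (i : 'I_C.+1) : 'I_#|T|.+1 := inord (n - (q + i)).
have le_i (i : 'I_C.+1) : q + i <= n.
  by apply: leq_trans leqCn; rewrite leq_add2l -ltnS.
have missE i : miss i = n - (q + i) :> nat.
  by rewrite inordK // cardT ltnS leq_subr.
have miss_inj : injective miss.
  move=> i j /(congr1 val); rewrite /= !missE => eq_ij; apply/val_inj/eqP.
  by rewrite -(eqn_add2l q) -(subKn (le_i i)) eq_ij subKn.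
have sub : clique_sizes k E \subset ~: (miss @: 'I_C.+1).
  apply/subsetP=> s; rewrite !inE => /existsP[S /andP[cliqueS /eqP szS]].
  apply/imsetP=> -[i _ s_i].
  have := gapq _ (mem_head _ _) _ (minset_transversal_clique cliqueS).
  rewrite cardsCs setCK szS s_i missE cardT subKn //.
  by rewrite leq_addr leq_add2l -ltnS ltn_ord.
have := subset_leq_card sub.
rewrite [#|~: _|]cardsCs setCK card_imset // !card_ord subSS => le_sizes.
apply: leq_trans (leq_add le_sizes (leqnn C)) _.
by rewrite cardT subnK // (leq_trans _ leqCn) ?leq_addl.
Qed.
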